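(* Let $\mathbb{K}$ be a field, let $\mathbb{L}$ be a field extension of $\mathbb{K}$, let $n$ and $p$ be positive integers and let $I$ be a set. Let $(A_i)_{i \in I}$ and $(B_i)_{i \in I}$ be two families of matrices of $\mathrm{M}_{n,p}(\mathbb{K})$. Then $(A_i)_{i \in I}$ and $(B_i)_{i \in I}$ are simultaneously equivalent in $\mathrm{M}_{n,p}(\mathbb{K})$ if and only if they are simultaneously equivalent in $\mathrm{M}_{n,p}(\mathbb{L})$.
   Context: For a field $\mathbb{F}$, $\mathrm{M}_{n,p}(\mathbb{F})$ denotes the $n\times p$ matrices over $\mathbb{F}$ and $\mathrm{GL}_n(\mathbb{F})$ the invertible $n \times n$ matrices. Two families $(A_i)_{i \in I}$ and $(B_i)_{i \in I}$ of matrices of $\mathrm{M}_{n,p}(\mathbb{F})$ indexed over the same set $I$ are simultaneously equivalent in $\mathrm{M}_{n,p}(\mathbb{F})$ when there exists a single pair $(P,Q) \in \mathrm{GL}_n(\mathbb{F}) \times \mathrm{GL}_p(\mathbb{F})$ such that $P A_i Q = B_i$ for all $i \in I$. Matrices over $\mathbb{K}$ are regarded as matrices over $\mathbb{L}$ via the inclusion $\mathbb{K} \subset \mathbb{L}$. The field extension is arbitrary (not assumed finite, algebraic or separable) and $I$ may be infinite. *)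

(* Defs.v *)
From mathcomp Require Import all_boot all_order all_algebra.

Set Implicit Arguments.
Unset Strict Implicit.
Unset Printing Implicit Defensive.

Import GRing.Theory.
Local Open Scope ring_scope.

Definition sim_equiv (F : fieldType) (n p : nat) (I : Type)
    (A B : I -> 'M[F]_(n, p)) : Prop :=
  exists (P : 'M[F]_n) (Q : 'M[F]_p),
    [/\ P \in unitmx, Q \in unitmx & forall i : I, P *m A i *m Q = B i].

(* Main.v *)
Require Import Defs.
From HB Require Import structures.
From mathcomp Require Import all_boot all_order all_algebra.
From mathcomp Require Import mxabelem.
From Stdlib Require Import Classical.

Set Implicit Arguments.
Unset Strict Implicit.
Unset Printing Implicit Defensive.

Import GRing.Theory.
Local Open Scope ring_scope.

(**
A pair [(P, R)] with [P A_i = B_i R] is a block-diagonal matrix [X] that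
intertwines two families of square matrices ([arrow_mx]), so the theorem follows
from the analogous descent for simultaneous similarity ([sim_similar_descent]).
There, the matrices over [K] intertwining [a] with [b] form the solution space
[V] of a linear system, and the solutions over [L] are the extension of [V] to
[L] ([exists_intertwiner_space]).  The question becomes: if the extension of [V]
contains an invertible [G], does [V] contain an invertible matrix
([unit_descent])?

If [K] is infinite, the determinant is a polynomial function on the extension of
[V] that does not vanish at [G].  The coordinates of [G] in a generating family
of [V] can be moved into [K] one at a time, since a nonzero polynomial in one
variable has a nonroot in [K] ([infinite_unit_descent]).

If [K] is finite, polynomial functions are of no help, and matrices are counted
instead ([finite_unit_descent]).  Let [U] be the space of matrices commuting
with the family [b].  Right multiplication by [G] maps the extension of [U] onto
that of [V] and, for every [T], preserves the condition [T *m X = 0].  Hence the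
subspaces of [U] and of [V] cut out by [T *m X = 0] have the same dimension,
which does not change under field extension, hence the same number of elements.
By inclusion-exclusion, [U] and [V] contain equally many matrices that kill no
nonzero row vector, that is, equally many invertible matrices; and [U] contains
the identity.  This replaces, for finite fields, an appeal to the Krull-Schmidt
theorem.
*)

(** * Intertwiners as the solutions of a linear system *)

(** Lets an infinite linear system be replaced by a finite one, for which the
solution space commutes with extension of scalars. *)
Lemma finite_subfamily_bigcapmx (F : fieldType) (N : nat) (J : Type)
    (W : J -> 'M[F]_N) :
  exists s : seq J, forall j, (\bigcap_(i <- s) W i <= W j)%MS.
Proof.
suff: forall r s, (\rank (\bigcap_(i <- s) W i)%MS <= r)%N ->
    exists s' : seq J, forall j, (\bigcap_(i <- s') W i <= W j)%MS.
  by move/(_ N [::]); apply; apply: rank_leq_row.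
elim=> [|r IHr] s rk_s.
  exists s => j; suff /eqP->: (\bigcap_(i <- s) W i)%MS == 0 by apply: sub0mx.
  by rewrite -mxrank_eq0 -leqn0.
have [[j nWj] | allW] := classic (exists j, ~~ (\bigcap_(i <- s) W i <= W j)%MS).
  (* A condition not implied by those of s strictly lowers the rank. *)
  apply: (IHr (j :: s)); rewrite big_cons -ltnS; apply: leq_trans rk_s.
  rewrite rank_ltmx // ltmxE capmxSr sub_capmx submx_refl andbT; exact: nWj.
by exists s => j; apply/negPn/negP=> nWj; apply: allW; exists j.
Qed.

Definition intertwining_mx (F : fieldType) (m : nat) (a b : 'M[F]_m) :
    'M[F]_(m * m) := lin_mulmxr a - lin_mulmx b.

Lemma mul_intertwining_mx (F : fieldType) (m : nat) (a b X : 'M[F]_m) :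
  mxvec X *m intertwining_mx a b = mxvec (X *m a - b *m X).
Proof. by rewrite mulmxBr !mul_vec_lin linearB. Qed.

Lemma map_intertwining_mx (K L : fieldType) (iota : {rmorphism K -> L})
    (m : nat) (a b : 'M[K]_m) :
  map_mx iota (intertwining_mx a b) =
    intertwining_mx (map_mx iota a) (map_mx iota b).
Proof.
by rewrite /intertwining_mx map_mxB; congr (_ - _); apply: map_lin_mx => X;
   rewrite map_mxM.
Qed.

(** The same matrix [H] over [K] serves all extensions [L], because the kernel of
a matrix over [K] and finite intersections of such kernels are computed by
Gaussian elimination inside [K]. *)
Lemma exists_intertwiner_space (K : fieldType) (m : nat) (J : Type)
    (a b : J -> 'M[K]_m) :
  exists H : 'M[K]_(m * m),
    forall (L : fieldType) (iota : {rmorphism K -> L}) (Y : 'M[L]_m),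
      (mxvec Y <= map_mx iota H)%MS <->
      forall j, Y *m map_mx iota (a j) = map_mx iota (b j) *m Y.
Proof.
pose W j := kermx (intertwining_mx (a j) (b j)).
have [s sW] := finite_subfamily_bigcapmx W.
exists (\bigcap_(i <- s) W i)%MS => L iota Y.
have WP j : (mxvec Y <= map_mx iota (W j))%MS <->
    Y *m map_mx iota (a j) = map_mx iota (b j) *m Y.
  rewrite map_kermx map_intertwining_mx; split=> [/sub_kermxP | eqY].
    rewrite mul_intertwining_mx => /eqP.
    by rewrite mxvec_eq0 subr_eq0 => /eqP.
  by apply/sub_kermxP; rewrite mul_intertwining_mx eqY subrr linear0.
split=> [Ys j | allY].
  by apply/WP/(submx_trans Ys); rewrite map_submx.
elim: s {sW} => [|j s IHs]; first by rewrite big_nil map_mx1 submx1.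
by rewrite big_cons map_capmx sub_capmx IHs andbT; apply/WP.
Qed.

(** * Finite ground field: counting *)

(** Right multiplication by [G] is injective and preserves [T *m X = 0], so over
[L] it embeds one subspace into the other; ranks may then be compared over
[K]. *)
Lemma leq_rank_annihilator (K L : fieldType) (iota : {rmorphism K -> L})
    (m r : nat) (U V : 'M[K]_(m * m)) (G : 'M[L]_m) (T : 'M[K]_(r, m)) :
    G \in unitmx ->
    (forall Y, (mxvec Y <= map_mx iota U)%MS ->
       (mxvec (Y *m G) <= map_mx iota V)%MS) ->
  (\rank (U :&: kermx (lin_mulmx T))%MS
     <= \rank (V :&: kermx (lin_mulmx T))%MS)%N.
Proof.
move=> uG UGV.
have freeG : row_free (lin_mulmxr G : 'M_(m * m)).
  apply: inj_row_free => v /eqP; rewrite -[v]vec_mxK mul_vec_lin /= mxvec_eq0.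
  move=> /eqP vG0; apply/eqP; rewrite mxvec_eq0 -[vec_mx v](mulmxK uG) vG0.
  by rewrite mul0mx.
have mapT : map_mx iota (lin_mulmx T) =
    lin_mulmx (map_mx iota T) :> 'M_(m * m, r * m).
  by apply: map_lin_mx => X; rewrite map_mxM.
rewrite -[X in (X <= _)%N](mxrank_map iota) -[X in (_ <= X)%N](mxrank_map iota).
rewrite !map_capmx !map_kermx mapT.
rewrite -[X in (X <= _)%N](mxrankMfree _ freeG); apply: mxrankS.
apply/row_subP=> i; rewrite row_mul.
have := row_sub i (map_mx iota U :&: kermx (lin_mulmx (map_mx iota T)))%MS.
rewrite -[row i _]vec_mxK; move: (vec_mx _) => Y.
rewrite mul_vec_lin /= !sub_capmx => /andP[/UGV-> /sub_kermxP].
rewrite mul_vec_lin => /eqP; rewrite mxvec_eq0 => /eqP TY0 /=.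
by apply/sub_kermxP; rewrite mul_vec_lin /= mulmxA TY0 mul0mx linear0.
Qed.

Definition killing_sparing (F : finFieldType) (m r : nat) (V : 'M[F]_(m * m))
    (T : 'M[F]_(r, m)) (s : seq 'rV[F]_m) : {set 'rV[F]_(m * m)} :=
  [set v | [&& (v <= V)%MS, T *m vec_mx v == 0 &
               all (fun t => t *m vec_mx v != 0) s]].

(** Inclusion-exclusion on the vectors [s] to be spared: the matrices that kill
[T] and spare [s] split according to whether they also kill a new vector [t],
and killing [t] amounts to adjoining the row [t] to [T]. *)
Lemma eq_card_killing_sparing (F : finFieldType) (m : nat)
    (U V : 'M[F]_(m * m)) :
    (forall (r : nat) (T : 'M[F]_(r, m)),
       \rank (U :&: kermx (lin_mulmx T))%MS
         = \rank (V :&: kermx (lin_mulmx T))%MS) ->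
  forall (s : seq 'rV[F]_m) (r : nat) (T : 'M[F]_(r, m)),
    #|killing_sparing U T s| = #|killing_sparing V T s|.
Proof.
move=> eqUV; elim=> [|t s IHs] r T.
  have killE (W : 'M[F]_(m * m)) :
      killing_sparing W T [::] = rowg (W :&: kermx (lin_mulmx T))%MS.
    apply/setP=> v; rewrite inE mem_rowg sub_capmx andbT; congr (_ && _).
    rewrite -[in RHS](vec_mxK v) (sameP sub_kermxP eqP) mul_vec_lin /=.
    by rewrite mxvec_eq0.
  by rewrite !killE !card_rowg eqUV.
have killD (W : 'M[F]_(m * m)) :
    #|killing_sparing W T s| =
      (#|killing_sparing W (col_mx T t) s| + #|killing_sparing W T (t :: s)|)%N.
  rewrite -(cardsID [set v | t *m vec_mx v == 0]); congr (_ + _)%N;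
    apply: eq_card => v; rewrite !inE /= ?mul_col_mx ?col_mx_eq0;
    by do ![case: (_ <= _)%MS | case: eqP | case: all].
by apply/eqP; rewrite -(eqn_add2l #|killing_sparing U (col_mx T t) s|) -killD;
   rewrite (IHs _ (col_mx T t)) -killD IHs.
Qed.

(** A square matrix is invertible when it spares every nonzero row vector, so the
count applies to the list of all of them, with an empty [T]. *)
Lemma finite_unit_descent (F : finFieldType) (L : fieldType)
    (iota : {rmorphism F -> L}) (m : nat) (U V : 'M[F]_(m * m))
    (G : 'M[L]_m) :
    G \in unitmx -> (mxvec 1%:M <= U)%MS ->
    (forall Y, (mxvec Y <= map_mx iota U)%MS <->
       (mxvec (Y *m G) <= map_mx iota V)%MS) ->
  exists2 X, X \in unitmx & (mxvec X <= V)%MS.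
Proof.
move=> uG U1 UV.
have eqUV r (T : 'M[F]_(r, m)) : \rank (U :&: kermx (lin_mulmx T))%MS
         = \rank (V :&: kermx (lin_mulmx T))%MS.
  apply/eqP; rewrite eqn_leq; apply/andP; split.
    by apply: (leq_rank_annihilator (iota := iota) T uG) => Y /UV.
  apply: (@leq_rank_annihilator _ _ iota _ _ _ _ (invmx G)) => [|Y VY].
    by rewrite unitmx_inv.
  by apply/UV; rewrite mulmxKV.
pose s := enum [pred t : 'rV[F]_m | t != 0].
have := eq_card_killing_sparing eqUV s (0 : 'M_(0, m)).
have: mxvec 1%:M \in killing_sparing U (0 : 'M_(0, m)) s.
  rewrite inE U1 mxvecK mul0mx eqxx /=; apply/allP=> t.
  by rewrite mem_enum mulmx1.
move=> U1s cardUV; have: (0 < #|killing_sparing V (0 : 'M_(0, m)) s|)%N.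
  by rewrite -cardUV; apply/card_gt0P; exists (mxvec 1%:M).
case/card_gt0P=> v; rewrite inE => /and3P[Vv _ /allP vs].
exists (vec_mx v); last by rewrite vec_mxK.
rewrite -row_free_unit; apply: inj_row_free => t tv0; apply/eqP.
apply: contraT => nz_t; have := vs t; rewrite mem_enum tv0 eqxx.
by move/(_ nz_t).
Qed.

(** * Infinite ground field: nonvanishing of the determinant *)
Lemma infinite_nonroot (K L : fieldType) (iota : {rmorphism K -> L})
    (q : {poly L}) :
    (forall s : seq K, exists x, x \notin s) -> q != 0 ->
  exists c, q.[iota c] != 0.
Proof.
move=> infK nz_q.
have [s [uniq_s sz_s]] : exists s : seq K, uniq s /\ size s = size q.
  elim: (size q) => [|n [s [us <-]]]; first by exists [::].
  by have [x xs] := infK s; exists (x :: s); rewrite /= xs.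
apply: NNPP => noroot; have/negP[] := ltnn (size q).
rewrite -{1}sz_s -(size_map iota) max_poly_roots //.
  apply/allP=> _ /mapP[c _ ->]; apply/negPn/negP=> qc.
  by apply: noroot; exists c.
by rewrite map_inj_uniq //; apply: fmorph_inj.
Qed.

(** On the line [C + x D] the determinant is a polynomial in [x], evaluated here
through the matrix of polynomials [C + 'X D]. *)
Lemma infinite_line_unit (K L : fieldType) (iota : {rmorphism K -> L})
    (m : nat) (C D : 'M[L]_m) (x : L) :
    (forall s : seq K, exists x, x \notin s) -> C + x *: D \in unitmx ->
  exists c, C + iota c *: D \in unitmx.
Proof.
move=> infK uCD; pose q := \det (map_mx polyC C + 'X *: map_mx polyC D).
have qE y : q.[y] = \det (C + y *: D).
  rewrite -horner_evalE -det_map_mx; congr (\det _); apply/matrixP=> i j.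
  by rewrite !mxE /= horner_evalE !hornerE.
have nz_q : q != 0.
  apply: contraTneq uCD => q0.
  by rewrite unitmxE -qE q0 horner0 unitr0.
have [c qc] := infinite_nonroot iota infK nz_q.
by exists c; rewrite unitmxE -qE unitfE.
Qed.

(** The coordinates [w] of [G] on the rows of [V] are replaced one by one by
elements of [K], each replacement being a move along a line that meets the
invertible matrices. *)
Lemma infinite_unit_descent (K L : fieldType) (iota : {rmorphism K -> L})
    (m N : nat) (V : 'M[K]_(N, m * m)) (G : 'M[L]_m) :
    (forall s : seq K, exists x, x \notin s) ->
    G \in unitmx -> (mxvec G <= map_mx iota V)%MS ->
  exists2 X, X \in unitmx & (mxvec X <= V)%MS.
Proof.
move=> infK uG /submxP[w defG].
have replace_upto k : (k <= N)%N -> exists2 w' : 'rV[L]_N,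
    (forall i : 'I_N, (i < k)%N -> exists c, w' 0 i = iota c)
  & vec_mx (w' *m map_mx iota V) \in unitmx.
  elim: k => [|k IHk] lekN.
    by exists w => //; rewrite -defG mxvecK.
  have [w' Kw' uw'] := IHk (ltnW lekN); pose k0 := Ordinal lekN.
  (* w0 is w' with its k-th coordinate set to zero. *)
  pose d : 'rV[L]_N := delta_mx 0 k0.
  pose w0 := w' - w' 0 k0 *: d.
  have lineE z : vec_mx (w0 *m map_mx iota V) + z *: vec_mx (d *m map_mx iota V)
      = vec_mx ((w0 + z *: d) *m map_mx iota V).
    by rewrite -linearZ -linearD /= scalemxAl -mulmxDl.
  have [|c] := @infinite_line_unit K L iota m (vec_mx (w0 *m map_mx iota V))
      (vec_mx (d *m map_mx iota V)) (w' 0 k0) infK.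
    by rewrite lineE subrK.
  rewrite lineE => uc; exists (w0 + iota c *: d) => //.
  move=> i; rewrite ltnS leq_eqVlt => /orP[/eqP eqik | ltik].
    have ->: i = k0 by apply: val_inj.
    by exists c; rewrite !mxE !eqxx !mulr1 subrr add0r.
  have [e we] := Kw' i ltik; exists e.
  have /negPf nik : i != k0 by rewrite -val_eqE /= ltn_eqF.
  by rewrite !mxE nik !andbF !mulr0 subr0 addr0.
have [w' Kw' uw'] := replace_upto N (leqnn N).
have /fin_all_exists[c cE] : forall i : 'I_N, exists c, w' 0 i = iota c.
  by move=> i; apply: Kw'.
have defw' : w' = map_mx iota (\row_i c i).
  by apply/rowP=> i; rewrite !mxE cE.
exists (vec_mx (\row_i c i *m V)); last by rewrite vec_mxK submxMl.
by rewrite -(map_unitmx iota) map_vec_mx map_mxM -defw'.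
Qed.

(** * Descent over an arbitrary ground field *)

(** The equality is one of field structures and not merely of carriers, so
that it can be eliminated in statements about [K]. *)
Lemma finFieldType_of_covering_seq (K : fieldType) (s : seq K) :
  (forall x, x \in s) -> exists F : finFieldType, F = K :> fieldType.
Proof.
move=> sK.
have pickK : pcancel (index^~ s) (fun i => Some (nth 0 s i)).
  by move=> x; rewrite nth_index.
have finK : Finite.axiom (undup s).
  by move=> x; rewrite count_uniq_mem ?undup_uniq // mem_undup sK.
pose cK := Choice_isCountable.Build K pickK.
pose fK := isFinite.Build K finK.
pose F : finFieldType := HB.pack (GRing.Field.sort K) (GRing.Field.class K) cK fK.
by exists F; case: K s sK pickK finK @cK @fK @F.
Qed.

Lemma unit_descent (K L : fieldType) (iota : {rmorphism K -> L}) (m : nat)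
    (U V : 'M[K]_(m * m)) (G : 'M[L]_m) :
    G \in unitmx -> (mxvec 1%:M <= U)%MS ->
    (forall Y, (mxvec Y <= map_mx iota U)%MS <->
       (mxvec (Y *m G) <= map_mx iota V)%MS) ->
  exists2 X, X \in unitmx & (mxvec X <= V)%MS.
Proof.
move=> uG U1 UV.
have [[s sK] | infK] := classic (exists s : seq K, forall x, x \in s).
  have [F eqFK] := finFieldType_of_covering_seq sK.
  case: K / eqFK iota U V U1 UV {s sK} => iota U V U1 UV.
  exact: finite_unit_descent uG U1 UV.
apply: (@infinite_unit_descent _ _ iota _ _ _ G) => // [s|].
  apply: NNPP => sK; apply: infK; exists s => x.
  by apply/negPn/negP=> xs; apply: sK; exists x.
by rewrite -[G]mul1mx; apply/UV; rewrite -(map_mx1 iota) -map_mxvec map_submx.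
Qed.

Lemma sim_similar_descent (K L : fieldType) (iota : {rmorphism K -> L})
    (m : nat) (J : Type) (a b : J -> 'M[K]_m) (G : 'M[L]_m) :
    G \in unitmx ->
    (forall j, G *m map_mx iota (a j) = map_mx iota (b j) *m G) ->
  exists2 X, X \in unitmx & forall j, X *m a j = b j *m X.
Proof.
move=> uG Gab.
have [U UP] := exists_intertwiner_space b b.
have [V VP] := exists_intertwiner_space a b.
have U1 : (mxvec 1%:M <= U)%MS.
  rewrite -(map_submx iota) map_mxvec map_mx1; apply/UP => j.
  by rewrite mulmx1 mul1mx.
have [|X uX VX] := @unit_descent K L iota m U V G uG U1.
  move=> Y; rewrite UP VP; split=> Yj j.
    by rewrite -mulmxA Gab !mulmxA Yj.
  by apply: (can_inj (mulmxK uG)); rewrite /= -mulmxA -Gab mulmxA Yj mulmxA.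
exists X => // j; apply: (map_mx_inj (f := iota)); rewrite !map_mxM.
by move: j; apply/VP; rewrite -map_mxvec map_submx.
Qed.

(** The two spaces [F^n] and [F^p] with the maps [A i] between them form one
module [F^(n + p)]: each [A i] acts as an off-diagonal block, and the extra
index [None] acts as the projection on [F^n], which forces an intertwiner to be
block-diagonal. *)
Definition arrow_mx (F : fieldType) (n p : nat) (I : Type)
    (A : I -> 'M[F]_(n, p)) (o : option I) : 'M[F]_(n + p) :=
  if o is Some i then block_mx 0 (A i) 0 0 else block_mx 1%:M 0 0 0.

(* MathComp world. The extension L of K is given by its embedding iota, a ring
   morphism between fields (hence injective). *)
Theorem theorem2 (K L : fieldType) (iota : {rmorphism K -> L}) (n p : nat)
    (n_gt0 : (0 < n)%N) (p_gt0 : (0 < p)%N) (I : Type)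
    (A B : I -> 'M[K]_(n, p)) :
  sim_equiv A B <->
  sim_equiv (fun i : I => map_mx iota (A i)) (fun i : I => map_mx iota (B i)).
Proof.
split=> [[P [Q [uP uQ PAQ]]] | [P [Q [uP uQ PAQ]]]].
  exists (map_mx iota P), (map_mx iota Q).
  by rewrite !map_unitmx; split=> // i; rewrite -!map_mxM PAQ.
(* P A Q = B reads P A = B Q^-1, hence the inverse in the second block. *)
pose G := block_mx P 0 0 (invmx Q).
have uG : G \in unitmx.
  by rewrite unitmxE det_ublock unitrM -!unitmxE uP unitmx_inv.
have [|X uX XAB] :=
    @sim_similar_descent K L iota _ _ (arrow_mx A) (arrow_mx B) G uG.
  case=> [i|] /=; rewrite !map_block_mx ?map_mx1 !map_mx0 !mulmx_block;
    rewrite !(mul0mx, mulmx0, mulmx1, mul1mx, addr0, add0r) //.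
  by have /= <- := PAQ i; rewrite mulmxK.
move: uX XAB; rewrite -[X]submxK.
move: (ulsubmx X) (ursubmx X) (dlsubmx X) (drsubmx X) => R Z W S uX XAB.
(* Commuting with the projection on F^n kills the off-diagonal blocks. *)
have := XAB None; rewrite /= !mulmx_block.
rewrite !(mul0mx, mulmx0, mulmx1, mul1mx, addr0, add0r).
case/eq_block_mx=> _ Z0 W0 _.
move: uX; rewrite -Z0 W0 unitmxE det_ublock unitrM -!unitmxE => /andP[uR uS].
exists R, (invmx S); split; rewrite ?unitmx_inv // => i.
have := XAB (Some i); rewrite /= !mulmx_block.
rewrite !(mul0mx, mulmx0, mulmx1, mul1mx, addr0, add0r).
by case/eq_block_mx=> _ RA _ _; rewrite RA mulmxK.
Qed.
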